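(* Let $\ell\ge1$. Suppose there is a function $f:\mathbb{R}\to\mathbb{R}$ with $\liminf_{x\to\infty}f(x)=\infty$ and an increasing sequence $(x_i)_{i\in\mathbb{N}}$ of real numbers with $x_i\to\infty$ such that $\mathrm{S}^{\ell}(x_i)\ge \mathrm{V}^{\ell}(x_i)\, f(x_i)$ for all $i$. Then $\limsup_{m\in\mathscr{V}^{\ell}}\mathrm{A}(m)=\infty$.
   Context: $\phi$ is Euler's totient function, $\mathscr{V}$ its set of values, $\mathrm{A}(m)=|\phi^{-1}(m)|$, $\mathscr{V}^{\ell}=\{m\in\mathscr{V}: m\equiv 2^{\ell}\pmod{2^{\ell+1}}\}$, $\mathrm{V}^{\ell}(x)=|\{m\in\mathscr{V}^{\ell}: m\le x\}|$, and $\mathrm{S}^{\ell}(x)=\sum_{m\in\mathscr{V}^{\ell},\,m\le x}\mathrm{A}(m)$. *)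

(* Defs.v *)
From HB Require Import structures.
From mathcomp Require Import all_boot all_order all_algebra.
From mathcomp Require Import finmap.
From mathcomp Require Import all_classical all_reals all_analysis.

Set Implicit Arguments.
Unset Strict Implicit.
Unset Printing Implicit Defensive.

Import Order.TTheory GRing.Theory Num.Theory.
Local Open Scope classical_set_scope.
Local Open Scope ring_scope.

(* [totient 0 = 0] in the library, whereas phi is defined on positive integers
   only: 0 is excluded here, so it is not a totient value. *)
Definition totient_fiber (m : nat) : set nat :=
  [set n | (0 < n)%N /\ totient n = m].

Definition totient_values : set nat := totient @` [set n | (0 < n)%N].

(* [fset_set] is meaningful on finite sets only; see [finite_totient_fiber]. *)
Definition totient_mult (m : nat) : nat := #|` fset_set (totient_fiber m)|.

Definition totient_values_at (l : nat) : set nat :=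
  [set m | totient_values m /\ m = 2 ^ l %[mod 2 ^ l.+1]].

Definition totient_values_le (R : realType) (l : nat) (x : R) : set nat :=
  [set m | totient_values_at l m /\ m%:R <= x].

Definition Vcount (R : realType) (l : nat) (x : R) : nat :=
  #|` fset_set (totient_values_le l x)|.

Definition Scount (R : realType) (l : nat) (x : R) : nat :=
  (\sum_(m <- fset_set (totient_values_le l x)) totient_mult m)%N.

Lemma totient_fiber_bound (m n : nat) :
  totient_fiber m n -> (n <= m * (m.+1)`!)%N.
Proof.
move=> [n_gt0 <-].
have tn := totientE n_gt0.
have t_gt0 : (0 < totient n)%N by rewrite totient_gt0.
have p_le p : p \in primes n -> (p <= (totient n).+1)%N.
  move=> pn; have p_pr : prime p by move: pn; rewrite mem_primes => /andP[].
  have dv : (p.-1 %| totient n)%N.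
    by rewrite tn (big_rem p pn)/= -mulnA dvdn_mulr.
  by rewrite -(prednK (prime_gt0 p_pr)) ltnS dvdn_leq.
have rad_le : (\prod_(p <- primes n) p <= ((totient n).+1)`!)%N.
  rewrite fact_prod -(big_rmcond_in (fun p => p \in primes n)) //=; last first.
    by move=> p ->.
  rewrite (@bigID _ _ _ _ (index_iota 1 (totient n).+2) (mem (primes n)))/=.
  rewrite -[leqLHS]muln1 leq_mul //; last first.
    rewrite big_seq_cond prodn_cond_gt0 // => i.
    by rewrite mem_index_iota => /andP[/andP[]].
  rewrite -[X in (_ <= X)%N]big_filter -[X in (X <= _)%N]big_filter.
  rewrite eq_leq //; apply: perm_big; apply: uniq_perm.
  - exact/filter_uniq/primes_uniq.
  - exact/filter_uniq/iota_uniq.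
  move=> p; rewrite !mem_filter mem_index_iota.
  case pn: (p \in primes n) => //=.
  by rewrite ltnS p_le // andbT; move: pn; rewrite mem_primes => /andP[/prime_gt0].
rewrite (leq_trans _ (leq_mul (leqnn _) rad_le)) // tn -big_split /=.
rewrite [leqLHS](prod_prime_decomp n_gt0) prime_decompE big_map /=.
rewrite big_seq [leqRHS]big_seq leq_prod // => p pn.
have p_pr : prime p by move: pn; rewrite mem_primes => /andP[].
have lg : (0 < logn p n)%N by rewrite logn_gt0.
rewrite -mulnA -expnSr prednK // leq_pmull //.
by rewrite -ltnS prednK ?prime_gt1 ?prime_gt0.
Qed.

Lemma finite_totient_fiber (m : nat) : finite_set (totient_fiber m).
Proof.
apply: (sub_finite_set _ (finite_II (m * (m.+1)`!).+1)) => n /=.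
by rewrite ltnS; exact: totient_fiber_bound.
Qed.

Lemma finite_totient_values_le (R : realType) (l : nat) (x : R) :
  finite_set (totient_values_le l x).
Proof.
apply: (sub_finite_set _ (finite_II (Num.truncn x).+1)) => m /= [_ mx].
rewrite ltnS truncn_ge_nat //.
exact: le_trans mx.
Qed.

(* Main.v *)
Require Import Defs.
From HB Require Import structures.
From mathcomp Require Import all_boot all_order all_algebra.
From mathcomp Require Import finmap.
From mathcomp Require Import all_classical all_reals all_analysis.

(** If the limsup were finite, [A] would be bounded on the whole of V^l by some
    constant [K], so that S^l(x) <= K V^l(x) for all [x]. As 2^l = phi(2^(l+1))
    lies in V^l, V^l(x_i) > 0 for large [i]; hence f(x_i) <= K for large [i],
    contradicting f -> oo. *)

Import Order.TTheory GRing.Theory Num.Theory.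
Import numFieldNormedType.Exports.
Local Open Scope classical_set_scope.
Local Open Scope ring_scope.

(** The limsup is the infimum of the suprema of [g] over the members of [F], so if it is below
    [+oo], some member [V] has supremum below [+oo]. *)
Lemma near_le_of_limf_esup_lty {R : realType} {U : choiceType}
    {T : filteredType U} {F : set_system T} {FF : Filter F} {g : T -> R} :
  (limf_esup (fun t => (g t)%:E) F < +oo)%E ->
  exists B : R, F [set t | g t <= B].
Proof.
rewrite limf_esupE => /ereal_inf_lt[_ [V FV <-]].
have gV t : V t -> ((g t)%:E <= ereal_sup [set (g t)%:E | t in V])%E.
  by move=> Vt; apply: ereal_sup_ubound; exists t.
case: ereal_sup gV => [r| |] gV // _.
- by exists r; apply: filterS FV => t /gV.
(* Supremum [-oo]: [g] is real-valued, so [V] is empty and any bound serves. *)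
- by exists 0; apply: filterS FV => t /gV.
Qed.

Lemma near_gt_of_limf_einf_pinfty {R : realType} {U : choiceType}
    {T : filteredType U} {F : set_system T} {FF : Filter F} {g : T -> R}
    (B : R) :
  limf_einf (fun t => (g t)%:E) F = +oo%E -> F [set t | B < g t].
Proof.
rewrite limf_einfE => infy.
have : (B%:E < +oo)%E by rewrite ltry.
rewrite -infy => /ereal_sup_gt[_ [V FV <-]] BV.
apply: filterS FV => t Vt /=; rewrite -lte_fin (lt_le_trans BV) //.
by apply: ereal_inf_lbound; exists t.
Qed.

(** Only finitely many indices precede the threshold [N]; their maximum absorbs them. *)
Lemma nat_bounded_of_near (R : realType) (D : set nat) (a : nat -> nat)
    (B : R) :
  (\forall m \near within D \oo, (a m)%:R <= B) ->
  exists K, forall m, D m -> (a m <= K)%N.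
Proof.
move=> [N _ aB]; exists (maxn (Num.truncn B) (\max_(m < N) a m)) => m Dm.
rewrite leq_max; have [Nm|mN] := leqP N m.
  have aBm := aB m Nm Dm.
  (* Truncating [B] loses nothing, as [a m] is an integer; [0 <= B] follows from [0 <= a m <= B]. *)
  by rewrite truncn_ge_nat ?aBm // (le_trans _ aBm).
by apply/orP; right; exact: (@leq_bigmax _ (fun i : 'I_N => a i) (Ordinal mN)).
Qed.

Lemma totient_values_at_exp2 (l : nat) : totient_values_at l (2 ^ l)%N.
Proof.
split=> //; exists (2 ^ l.+1)%N; first by rewrite /= expn_gt0.
by rewrite totient_pfactor // mul1n.
Qed.

Lemma Vcount_gt0 (R : realType) (l : nat) (x : R) :
  (2 ^ l)%:R <= x -> (0 < Vcount l x)%N.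
Proof.
move=> lx; rewrite /Vcount cardfs_gt0; apply/fset0Pn; exists (2 ^ l)%N.
rewrite in_fset_set; last exact: finite_totient_values_le.
by rewrite inE; split => //; exact: totient_values_at_exp2.
Qed.

Lemma Scount_le (R : realType) (l K : nat) (x : R) :
  (forall m, totient_values_at l m -> (totient_mult m <= K)%N) ->
  (Scount l x <= Vcount l x * K)%N.
Proof.
move=> AK; rewrite /Scount /Vcount -sum1_size big_distrl /=.
rewrite big_seq [leqRHS]big_seq; apply: leq_sum => m.
rewrite in_fset_set; last exact: finite_totient_values_le.
by rewrite inE mul1n => -[/AK].
Qed.

Theorem theorem3p3 (R : realType) (l : nat) (hl : (1 <= l)%N)
    (f : R -> R) (x : nat -> R)
    (hf : limf_einf (fun t : R => (f t)%:E) (pinfty_nbhs R) = +oo%E)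
    (x_incr : increasing_seq x)
    (x_infty : x i @[i --> \oo] --> +oo)
    (hSV : forall i : nat,
      (Scount l (x i))%:R >= (Vcount l (x i))%:R * f (x i)) :
  limf_esup (fun m : nat => ((totient_mult m)%:R : R)%:E)
    (within (totient_values_at l) \oo) = +oo%E.
Proof.
apply/eqP; apply: contraT; rewrite -ltey.
move=> /near_le_of_limf_esup_lty[B /nat_bounded_of_near[K AK]].
have fK : \forall i \near \oo, K%:R < f (x i).
  (* The set where [f] exceeds [K] is a neighbourhood of [+oo], so [x i] eventually enters it. *)
  exact: (x_infty _ (near_gt_of_limf_einf_pinfty K%:R hf)).
have xl : \forall i \near \oo, (2 ^ l)%:R <= x i.
  by move/cvgryPge: x_infty; exact.
have [i [Kfi /Vcount_gt0 Vi]] := filter_ex (filterI fK xl).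
have : (Vcount l (x i))%:R * f (x i) <= (Vcount l (x i))%:R * K%:R.
  by rewrite (le_trans (hSV i)) // -natrM ler_nat Scount_le.
(* Cancelling the positive count [Vcount l (x i)] leaves [f (x i) <= K], against [Kfi]. *)
by rewrite ler_pM2l ?ltr0n // leNgt Kfi.
Qed.
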